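(* For each $I\subseteq\{1,\dots,n\}$ there exist two subsets $\partial I$ and $\overline I$ of $\{1,\dots,n\}$ such that $$\{J\subseteq\{1,\dots,n\}\mid F_J=F_I\}=\{J\subseteq\{1,\dots,n\}\mid\partial I\subseteq J\subseteq\overline I\}.$$ Moreover: (1) the dimension of $F_I$ is $|\Pi|-|\overline I|$; (2) the stabilizer of $F_I$ in $W$ is $W\langle\Pi\setminus\Pi_{\partial I}\rangle$; (3) the barycenter of $F_I$ lies in the cone generated by $\{\breve\omega_i\mid i\in\partial I\}$; (4) $\{\overline I\mid I\subseteq\{1,\dots,n\}\}=\{I\subseteq\{1,\dots,n\}\mid\widehat\Phi(\widehat\Pi\setminus\Pi_I)\text{ is irreducible}\}$. In particular, the set of the standard parabolic faces is in bijection with the set of irreducible standard parabolic subsystems of the affine root system $\widehat\Phi$ that contain the affine root $\alpha_0$.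
   Context: $\Phi$ is a finite irreducible reduced crystallographic root system of rank $n$ in the Euclidean space $\mathrm{Span}_{\mathbb R}\Phi$ with scalar product $(\cdot,\cdot)$; $\Pi=\{\alpha_1,\dots,\alpha_n\}$ is a root basis, $\Phi^+$ the positive roots, $W$ the Weyl group, $\theta=\sum_{i=1}^n m_i\alpha_i$ the highest root, and $\breve\omega_1,\dots,\breve\omega_n$ the basis dual to $\Pi$, i.e. $(\breve\omega_i,\alpha_j)=\delta_{ij}$. $\mathcal P_\Phi$ is the convex hull of $\Phi$. For $I\subseteq\{1,\dots,n\}$: $\Pi_I=\{\alpha_i\mid i\in I\}$, $F_I=\{x\in\mathcal P_\Phi\mid(x,\breve\omega_i)=m_i\ \forall i\in I\}$ (so $F_\emptyset=\mathcal P_\Phi$). The faces $F_I$, for all $I\subseteq\{1,\dots,n\}$ including $\emptyset$, are called the standard parabolic faces. For $\Gamma\subseteq\Phi$, $W\langle\Gamma\rangle$ is the subgroup of $W$ generated by the reflections $s_\alpha$, $\alpha\in\Gamma$. The barycenter of $F_I$ means the barycenter (average) of the set of roots $F_I\cap\Phi$. The cone generated by a set is the set of its nonnegative real linear combinations ($\{0\}$ for the empty set). Affine root system: in $\mathrm{Span}_{\mathbb R}\Phi\oplus\mathbb R\delta$, with the scalar product extended so that $\mathbb R\delta$ is the kernel, $\widehat\Phi=\{\alpha+k\delta\mid\alpha\in\Phi,k\in\mathbb Z\}$, $\alpha_0=-\theta+\delta$, $\widehat\Pi=\Pi\cup\{\alpha_0\}$. For $\Gamma\subseteq\widehat\Pi$,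 $\widehat\Phi(\Gamma)$ is the standard parabolic root subsystem of $\widehat\Phi$ generated by $\Gamma$; it is irreducible iff $\Gamma$ is connected in the extended Dynkin diagram. *)

(* Defs.v *)
From HB Require Import structures.
From mathcomp Require Import all_boot all_order all_algebra.
From mathcomp Require Import finmap.
From mathcomp Require Import boolp classical_sets functions reals convex.

Set Implicit Arguments.
Unset Strict Implicit.
Unset Printing Implicit Defensive.

Import Order.TTheory GRing.Theory Num.Theory.

Local Open Scope classical_set_scope.
Local Open Scope ring_scope.

(** * Reflections and irreducibility with respect to a bilinear form *)

(* The form is a bare function, so that the same definition serves both for a
   scalar product and for its degenerate extension in the affine setting; it is
   only applied to non-isotropic [a]. *)
Definition reflection (R : realType) (V : lmodType R) (form : V -> V -> R)
    (a x : V) : V :=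
  x - (2 * form x a / form a a) *: a.

Definition irreducible (R : realType) (V : lmodType R) (form : V -> V -> R)
    (S : set V) : Prop :=
  S !=set0 /\
  forall A B : set V, A `|` B = S ->
    (forall x y, A x -> B y -> form x y = 0) -> A = set0 \/ B = set0.

(** * Finite root systems *)

Record root_system (R : realType) (E : vectType R) (dot : {dot E for idfun})
    (Phi : {fset E}) : Prop := RootSystem {
  root_span : <<Phi>>%VS = fullv;
  root_neq0 : 0 \notin Phi;
  root_reflection : forall a b, a \in Phi -> b \in Phi ->
    reflection dot a b \in Phi;
  root_crystallographic : forall a b, a \in Phi -> b \in Phi ->
    2 * dot b a / dot a a \is a Num.int;
  root_reduced : forall a (c : R), a \in Phi -> c *: a \in Phi ->
    c = 1 \/ c = -1
}.

Definition root_basis (R : realType) (E : vectType R) (Phi : {fset E})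
    (n : nat) (alpha : 'I_n -> E) : Prop :=
  [/\ basis_of fullv (codom alpha),
      forall i, alpha i \in Phi
    & forall b, b \in Phi -> exists c : 'I_n -> nat,
        b = \sum_i alpha i *+ c i \/ b = - \sum_i alpha i *+ c i].

Definition highest_root (R : realType) (E : vectType R) (Phi : {fset E})
    (n : nat) (alpha : 'I_n -> E) (theta : E) : Prop :=
  theta \in Phi /\
  forall b, b \in Phi -> exists c : 'I_n -> nat,
    theta - b = \sum_i alpha i *+ c i.

Definition lin_subgroup (R : realType) (E : vectType R)
    (G : set 'End(E)) : Prop :=
  [/\ forall f, G f -> lker f = 0%VS,
      G \1%VF,
      forall f g, G f -> G g -> G (f \o g)%VF
    & forall f, G f -> G (f^-1)%VF].

(* The group generated by the reflections in the elements of [Gamma];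
   [Gamma := Phi] gives the Weyl group. *)
Definition reflection_group (R : realType) (E : vectType R)
    (dot : {dot E for idfun}) (Gamma : set E) : set 'End(E) :=
  smallest (@lin_subgroup R E) [set linfun (reflection dot a) | a in Gamma].

Definition simple_roots (R : realType) (E : vectType R) (n : nat)
    (alpha : 'I_n -> E) (I : {set 'I_n}) : set E :=
  [set alpha i | i in [set` I]].

(** * Faces of the root polytope *)

Definition root_polytope (R : realType) (E : vectType R) (Phi : {fset E}) :
    set E :=
  smallest (@convex_set R E) [set` Phi].

Definition face (R : realType) (E : vectType R) (dot : {dot E for idfun})
    (Phi : {fset E}) (n : nat) (omega : 'I_n -> E) (m : 'I_n -> R)
    (I : {set 'I_n}) : set E :=
  [set x | root_polytope Phi x /\ forall i, i \in I -> dot x (omega i) = m i].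

(* [U] is the direction of the affine hull of [A]. *)
Definition has_dimension (R : realType) (E : vectType R) (A : set E)
    (d : nat) : Prop :=
  exists (x0 : E) (U : {vspace E}),
    [/\ A x0,
        forall x, A x -> x - x0 \in U,
        forall U' : {vspace E}, (forall x, A x -> x - x0 \in U') -> (U <= U')%VS
      & \dim U = d].

Definition stabilizer (R : realType) (E : vectType R) (G : set 'End(E))
    (A : set E) : set 'End(E) :=
  [set w | G w /\ [set w x | x in A] = A].

Definition root_barycenter (R : realType) (E : vectType R) (Phi : {fset E})
    (A : set E) : E :=
  let s := [seq x <- Phi | `[< A x >]] in
  (size s)%:R^-1 *: \sum_(x <- s) x.

Definition cone (R : realType) (E : vectType R) (A : set E) : set E :=
  [set x | exists (k : nat) (c : 'I_k -> R) (v : 'I_k -> E),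
    [/\ forall j, 0 <= c j, forall j, A (v j) & x = \sum_j c j *: v j]].

(** * The affine root system *)

(* The pair [(x, t) : E * R^o] stands for [x + t delta], so that the kernel
   of the extended form is the line spanned by [delta]. *)
Definition affine_form (R : realType) (E : vectType R)
    (dot : {dot E for idfun}) (x y : E * R^o) : R :=
  dot x.1 y.1.

Definition affine_roots (R : realType) (E : vectType R) (Phi : {fset E}) :
    set (E * R^o) :=
  [set x | x.1 \in Phi /\ exists k : int, x.2 = k%:~R].

Definition affine_embed (R : realType) (E : vectType R) (x : E) : E * R^o :=
  (x, 0).

Definition alpha0 (R : realType) (E : vectType R) (theta : E) : E * R^o :=
  (- theta, 1).

Definition affine_simple_roots (R : realType) (E : vectType R) (n : nat)
    (alpha : 'I_n -> E) (theta : E) : set (E * R^o) :=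
  alpha0 theta |` (@affine_embed R E @` range alpha).

Definition affine_root_subsystem (R : realType) (E : vectType R)
    (dot : {dot E for idfun}) (Phi : {fset E}) (S : set (E * R^o)) : Prop :=
  S `<=` affine_roots Phi /\
  forall a b, S a -> S b -> S (reflection (affine_form dot) a b).

(* For [Gamma] included in the affine simple roots this is the standard
   parabolic subsystem of [Gamma]. *)
Definition generated_subsystem (R : realType) (E : vectType R)
    (dot : {dot E for idfun}) (Phi : {fset E}) (Gamma : set (E * R^o)) :
    set (E * R^o) :=
  smallest (affine_root_subsystem dot Phi) Gamma.

Definition standard_parabolic (R : realType) (E : vectType R)
    (dot : {dot E for idfun}) (Phi : {fset E}) (n : nat) (alpha : 'I_n -> E)
    (theta : E) (S : set (E * R^o)) : Prop :=
  exists2 Gamma, Gamma `<=` affine_simple_roots alpha theta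
               & S = generated_subsystem dot Phi Gamma.

(* Main.v *)
Require Import Defs.
From HB Require Import structures.
From mathcomp Require Import all_boot all_order all_algebra.
From mathcomp Require Import finmap.
From mathcomp Require Import boolp classical_sets functions reals convex.
From mathcomp Require Import interval_inference ring.

Set Implicit Arguments.
Unset Strict Implicit.
Unset Printing Implicit Defensive.

Import Order.TTheory GRing.Theory Num.Theory.

Local Open Scope classical_set_scope.
Local Open Scope ring_scope.

(** Attach to each face [F_I] the set of roots it contains, i.e. the roots [b]
    whose coefficients [c_i(b) = dot b (omega i)] equal [m i] for [i] in [I];
    [F_I] depends only on this set, and the closure of [I] collects all indices
    whose coefficient is maximal on it.  Reflecting roots of [F_I] in the simple
    roots outside [I] shows that the complement of the closure is the connected
    component of [alpha0] in the extended Dynkin diagram with [Pi_I] removed;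
    the border of [I] consists of the nodes of the closure adjacent to that
    component, so [J] has the same component as [I] exactly when [J] lies
    between the border and the closure of [I].  The barycenter of [F_I] is
    dominant, and its simple roots of positive pairing are those of the border;
    since it is fixed by the stabilizer of [F_I], the stabilizer is the
    parabolic subgroup fixing a dominant vector.  Irreducibility of a generated
    affine subsystem reduces to connectedness of its simple roots because every
    linear functional vanishing on the generators vanishes on the subsystem. *)

(** * Reflections and words in simple reflections *)

Section Reflections.
Context (R : realType) (E : vectType R) (dot : {dot E for idfun}).

Lemma dotC x y : dot x y = dot y x.
Proof. by rewrite hermC expr0 mul1r. Qed.

Lemma dot_gt0 x : x != 0 -> 0 < dot x x.
Proof. exact: neq0_dnorm_gt0. Qed.

Lemma dot_neq0 x : x != 0 -> dot x x != 0.
Proof. by move=> /dot_gt0; rewrite lt0r => /andP[]. Qed.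

Lemma dot_eq0 x : dot x x = 0 -> x = 0.
Proof.
by move=> xx0; apply/eqP; apply: contraTT isT => /dot_neq0; rewrite xx0 eqxx.
Qed.

Lemma dotDl x y z : dot (x + y) z = dot x z + dot y z.
Proof. exact: linearDl. Qed.

Lemma dotBl x y z : dot (x - y) z = dot x z - dot y z.
Proof. exact: linearBl. Qed.

Lemma dotNl x z : dot (- x) z = - dot x z.
Proof. exact: linearNl. Qed.

Lemma dotZl a x z : dot (a *: x) z = a * dot x z.
Proof. exact: linearZl_LR. Qed.

Lemma dot_suml (I : Type) (r : seq I) (P : pred I) (f : I -> E) z :
  dot (\sum_(i <- r | P i) f i) z = \sum_(i <- r | P i) dot (f i) z.
Proof. exact: (linear_sumlz dot). Qed.

Lemma dotBr x y z : dot z (x - y) = dot z x - dot z y.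
Proof. by rewrite dotC dotBl !(dotC z). Qed.

Lemma dotNr x z : dot z (- x) = - dot z x.
Proof. by rewrite dotC dotNl dotC. Qed.

Lemma reflection_is_linear a : linear (reflection dot a).
Proof.
move=> k x y; rewrite /reflection dotDl dotZl scalerBr scalerA addrACA.
congr (_ + _); rewrite -opprD -scalerDl; congr (- (_ *: _)).
by rewrite mulrDr mulrDl [_ * (k * _)]mulrCA !mulrA.
Qed.

HB.instance Definition _ a := GRing.isLinear.Build R E E *:%R
  (reflection dot a) (reflection_is_linear a).

Lemma dot_reflection a x y :
  dot (reflection dot a x) y = dot x y - 2 * dot x a / dot a a * dot a y.
Proof. by rewrite dotBl dotZl. Qed.

Lemma reflection_id a x : dot x a = 0 -> reflection dot a x = x.
Proof. by move=> xa; rewrite /reflection xa mulr0 mul0r scale0r subr0. Qed.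

Lemma reflection_self a : a != 0 -> reflection dot a a = - a.
Proof.
move=> a0; rewrite /reflection mulfK ?dot_neq0// scaler_nat mulr2n.
by rewrite opprD addNKr.
Qed.

Lemma reflectionN a x : reflection dot (- a) x = reflection dot a x.
Proof.
by rewrite /reflection !dotNr !dotNl opprK mulrN mulNr scaleNr scalerN !opprK.
Qed.

Lemma reflectionK a : a != 0 -> involutive (reflection dot a).
Proof.
move=> a0 x; rewrite {1}/reflection {1}/reflection dot_reflection.
rewrite mulfVK ?dot_neq0// -addrA -opprD -scalerDl -[RHS]subr0.
congr (_ - _); apply/eqP; rewrite scaler_eq0; apply/orP; left.
by apply/eqP; have := dot_neq0 a0 => aa; field.
Qed.

Lemma reflection_isometry a x y : a != 0 ->
  dot (reflection dot a x) (reflection dot a y) = dot x y.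
Proof.
move=> a0; rewrite dot_reflection !(dotC _ (reflection _ _ _)) !dot_reflection.
by have := dot_neq0 a0 => aa; rewrite (dotC y x) (dotC a x); field.
Qed.

Lemma reflection_swap a x y : a != 0 ->
  dot (reflection dot a x) y = dot x (reflection dot a y).
Proof. by move=> a0; rewrite -(reflection_isometry _ y a0) reflectionK. Qed.

Lemma reflection_conj a b x : a != 0 ->
  reflection dot (reflection dot a b) x =
  reflection dot a (reflection dot b (reflection dot a x)).
Proof.
move=> a0; rewrite [in RHS](_ : reflection dot b _ = reflection dot a x -
   (2 * dot (reflection dot a x) b / dot b b) *: b)//.
rewrite linearB linearZ/= reflectionK//; congr (_ - _ *: _).
by rewrite reflection_isometry// reflection_swap.
Qed.

End Reflections.

(** * Simple roots, coefficients and the Weyl group *)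

Section RootBasis.
Context (R : realType) (E : vectType R) (dot : {dot E for idfun}).
Context (Phi : {fset E}) (n : nat) (alpha omega : 'I_n -> E).
Context (Phi_root : root_system dot Phi) (alpha_basis : root_basis Phi alpha).
Context (omega_dual : forall i j, dot (omega i) (alpha j) = (i == j)%:R).

Local Notation s_ i := (reflection dot (alpha i)).

Lemma coef_simple i j : dot (alpha i) (omega j) = (i == j)%:R.
Proof. by rewrite dotC omega_dual eq_sym. Qed.

Lemma orthogonal_basis_eq0 x : (forall i, dot x (alpha i) = 0) -> x = 0.
Proof.
move=> xa; apply: (@dot_eq0 _ _ dot).
case: alpha_basis => /andP[/eqP aspan _] _ _.
have /coord_span xE : x \in <<codom_tuple alpha>>%VS.
  by rewrite (_ : <<_>>%VS = fullv) ?memvf.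
rewrite [X in dot _ X]xE dotC dot_suml big1// => i _.
have /codomP[j ->] : (codom alpha)`_i \in codom alpha.
  by apply: mem_nth; rewrite size_tuple.
by rewrite dotZl dotC xa mulr0.
Qed.

Lemma omega_expansion x : x = \sum_i dot x (alpha i) *: omega i.
Proof.
apply/eqP; rewrite -subr_eq0; apply/eqP/orthogonal_basis_eq0 => i.
rewrite dotBl dot_suml (bigD1 i)//= dotZl omega_dual eqxx mulr1.
rewrite big1 ?addr0 ?subrr// => j ji.
by rewrite dotZl omega_dual (negbTE ji) mulr0.
Qed.

Lemma orthogonal_dual_basis_eq0 x : (forall i, dot x (omega i) = 0) -> x = 0.
Proof.
move=> xo; apply: (@dot_eq0 _ _ dot).
rewrite [X in dot X _](omega_expansion x) dot_suml big1// => i _.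
by rewrite dotZl (dotC _ (omega i)) xo mulr0.
Qed.

Lemma simple_expansion x : x = \sum_i dot x (omega i) *: alpha i.
Proof.
apply/eqP; rewrite -subr_eq0; apply/eqP/orthogonal_dual_basis_eq0 => i.
rewrite dotBl dot_suml (bigD1 i)//= dotZl coef_simple eqxx mulr1.
rewrite big1 ?addr0 ?subrr// => j ji.
by rewrite dotZl coef_simple (negbTE ji) mulr0.
Qed.

Lemma dot_expansion x y :
  dot x y = \sum_i dot x (omega i) * dot (alpha i) y.
Proof.
rewrite [X in dot X _](simple_expansion x) dot_suml.
by apply: eq_bigr => i _; rewrite dotZl.
Qed.

Lemma coef_nat_sum (c : 'I_n -> nat) i :
  dot (\sum_j alpha j *+ c j) (omega i) = (c i)%:R.
Proof.
rewrite dot_suml (bigD1 i)//= big1 ?addr0 => [|j ji].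
  by rewrite -scaler_nat dotZl coef_simple eqxx mulr1.
by rewrite -scaler_nat dotZl coef_simple (negbTE ji) mulr0.
Qed.

Lemma simple_root i : alpha i \in Phi.
Proof. by case: alpha_basis. Qed.

Lemma root_nonzero b : b \in Phi -> b != 0.
Proof. by apply: contraTneq => ->; exact: root_neq0 Phi_root. Qed.

Lemma simple_neq0 i : alpha i != 0.
Proof. exact/root_nonzero/simple_root. Qed.

Lemma simple_inj : injective alpha.
Proof.
move=> i j ij; have := coef_simple i j; rewrite ij coef_simple eqxx.
by case: eqP => // _ /eqP; rewrite oner_eq0.
Qed.

Lemma reflection_root a b : a \in Phi -> b \in Phi ->
  reflection dot a b \in Phi.
Proof. exact: root_reflection Phi_root a b. Qed.

Lemma root_opp b : b \in Phi -> - b \in Phi.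
Proof.
by move=> bP; rewrite -(reflection_self dot (root_nonzero bP)) reflection_root.
Qed.

Lemma root_coef_nat b : b \in Phi -> exists c : 'I_n -> nat,
  (forall i, dot b (omega i) = (c i)%:R) \/
  (forall i, dot b (omega i) = - (c i)%:R).
Proof.
move=> bP; case: alpha_basis => _ _ /(_ _ bP)[c bE]; exists c.
by case: bE => ->; [left|right] => i; rewrite ?dotNl coef_nat_sum.
Qed.

Lemma root_coef_sign b : b \in Phi ->
  (forall i, 0 <= dot b (omega i)) \/ (forall i, dot b (omega i) <= 0).
Proof.
move=> /root_coef_nat[c [cE|cE]]; [left|right] => i;
  by rewrite cE ?oppr_le0 ler0n.
Qed.

Lemma root_pos_coef_nat b : b \in Phi -> (forall i, 0 <= dot b (omega i)) ->
  exists c : 'I_n -> nat, forall i, dot b (omega i) = (c i)%:R.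
Proof.
move=> /root_coef_nat[c [cE|cE]] bpos; first by exists c.
by exists (fun=> 0%N) => i; apply/eqP; rewrite eq_le bpos cE oppr_le0 ler0n.
Qed.

Lemma coef_simple_reflection i j x :
  dot (s_ i x) (omega j) =
  dot x (omega j) - 2 * dot x (alpha i) / dot (alpha i) (alpha i) * (i == j)%:R.
Proof. by rewrite dot_reflection coef_simple. Qed.

Lemma coef_simple_reflection_neq i j x : i != j ->
  dot (s_ i x) (omega j) = dot x (omega j).
Proof.
by move=> ij; rewrite coef_simple_reflection (negbTE ij) mulr0 subr0.
Qed.

Lemma coef_simple_reflection_eq i x :
  dot (s_ i x) (omega i) =
  dot x (omega i) - 2 * dot x (alpha i) / dot (alpha i) (alpha i).
Proof. by rewrite coef_simple_reflection eqxx mulr1. Qed.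

Lemma simple_norm_gt0 i : 0 < dot (alpha i) (alpha i).
Proof. exact: dot_gt0 (simple_neq0 i). Qed.

(** The reflection lowers the coefficient at [i] by a positive multiple of [dot x (alpha i)], so a
    coefficient known to be maximal yields the sign of a pairing. *)
Lemma coef_reflection_le i x :
  (dot (s_ i x) (omega i) <= dot x (omega i)) = (0 <= dot x (alpha i)).
Proof.
rewrite coef_simple_reflection_eq gerBl mulrAC pmulr_rge0//.
by rewrite divr_gt0 ?ltr0n// simple_norm_gt0.
Qed.

Lemma coef_reflection_lt i x :
  (dot (s_ i x) (omega i) < dot x (omega i)) = (0 < dot x (alpha i)).
Proof.
rewrite coef_simple_reflection_eq gtrBl mulrAC pmulr_rgt0//.
by rewrite divr_gt0 ?ltr0n// simple_norm_gt0.
Qed.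

Lemma coef_reflection_gt i x :
  (dot x (omega i) < dot (s_ i x) (omega i)) = (dot x (alpha i) < 0).
Proof. by rewrite !real_ltNge ?num_real// coef_reflection_le. Qed.

(** Were the pairing positive, reflecting [alpha i] in [alpha j] would give a root with a negative
    coefficient at [j] and coefficient 1 at [i]. *)
Lemma simple_obtuse i j : i != j -> dot (alpha i) (alpha j) <= 0.
Proof.
move=> ij; rewrite leNgt; apply/negP; rewrite -coef_reflection_lt.
rewrite coef_simple (negbTE ij) => neg.
have := reflection_root (simple_root j) (simple_root i).
move=> /root_coef_sign[/(_ j)|/(_ i)]; first by rewrite leNgt neg.
by rewrite coef_simple_reflection_neq 1?eq_sym// coef_simple eqxx ler10.
Qed.

(* Only the coefficient at [i] changes, so a sign change forces [b] to be a
   multiple of [alpha i], hence [alpha i] itself since [Phi] is reduced. *)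
Lemma simple_reflection_pos i b : b \in Phi ->
  (forall j, 0 <= dot b (omega j)) -> b != alpha i ->
  forall j, 0 <= dot (s_ i b) (omega j).
Proof.
move=> bP bpos bi.
have [//|sneg] := root_coef_sign (reflection_root (simple_root i) bP).
have b0 j : j != i -> dot b (omega j) = 0.
  move=> ji; apply/eqP; rewrite eq_le bpos andbT.
  by rewrite -(@coef_simple_reflection_neq i) ?sneg// eq_sym.
have bE : b = dot b (omega i) *: alpha i.
  rewrite [LHS]simple_expansion (bigD1 i)//= big1 ?addr0// => j /b0 ->.
  by rewrite scale0r.
have := bP; rewrite bE => /(root_reduced Phi_root (simple_root i)) [] e.
  by move: bi; rewrite bE e scale1r eqxx.
by have := bpos i; rewrite e ler0N1.
Qed.

(** Weyl group elements are handled as words acting on vectors, which makes word length available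
    for induction. *)
Definition word (w : seq 'I_n) (x : E) : E := foldr (fun i => s_ i) x w.

Lemma word_cat u v x : word (u ++ v) x = word u (word v x).
Proof. exact: foldr_cat. Qed.

Lemma word_rcons u i x : word (rcons u i) x = word u (s_ i x).
Proof. exact: foldr_rcons. Qed.

Lemma wordK w : cancel (word w) (word (rev w)).
Proof.
elim: w => // i w IH x; rewrite rev_cons word_rcons/=.
by rewrite reflectionK ?IH// simple_neq0.
Qed.

Lemma word_isometry w x y : dot (word w x) (word w y) = dot x y.
Proof.
by elim: w => //= i w IH; rewrite reflection_isometry ?IH// simple_neq0.
Qed.

Lemma word_root w b : b \in Phi -> word w b \in Phi.
Proof. by move=> bP; elim: w => //= i w; exact/reflection_root/simple_root. Qed.

Lemma wordVK w : cancel (word (rev w)) (word w).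
Proof. by move=> x; rewrite -{1}[w]revK wordK. Qed.

Lemma word_reflection w a x :
  word w (reflection dot a x) = reflection dot (word w a) (word w x).
Proof.
elim: w => //= i w IH; rewrite IH reflection_conj ?simple_neq0//.
by rewrite reflectionK// simple_neq0.
Qed.

(** At some letter [k] of [u] the image of [alpha i] turns from positive to negative. By
    [simple_reflection_pos] that image is [alpha k], so moving [s_ i] past the letters to the right
    of [k] turns it into [s_ k], which cancels the letter. *)
Lemma exchange u i :
  (forall j, dot (word u (alpha i)) (omega j) <= 0) ->
  exists2 v, (size v < size u)%N & forall x, word u (s_ i x) = word v x.
Proof.
elim: u => [/(_ i)|k u IH]/=; first by rewrite coef_simple eqxx ler10.
move=> neg.
have [upos|/IH[v vu vE]] := root_coef_sign (word_root u (simple_root i)).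
  have [uk|uk] := eqVneq (word u (alpha i)) (alpha k).
    exists u => // x.
    by rewrite word_reflection uk reflectionK// simple_neq0.
  have spos := simple_reflection_pos (word_root u (simple_root i)) upos uk.
  have : word (k :: u) (alpha i) = 0.
    by apply: orthogonal_dual_basis_eq0 => j; apply/eqP; rewrite eq_le neg/=.
  move/eqP; rewrite (negbTE (root_nonzero _))//.
  exact/word_root/simple_root.
by exists (k :: v) => //= x; rewrite vE.
Qed.

(* By [exchange], every reduced word for [w] ends in the reflection in a simple
   root [a] with [w a] negative, and then [dot b a = dot b (w a)] vanishes. *)
Lemma dominant_stabilizer b w : (forall i, 0 <= dot b (alpha i)) ->
  word w b = b ->
  exists2 v, all (fun i => dot b (alpha i) == 0) v &
             forall x, word w x = word v x.
Proof.
move=> bdom; have [k] := ubnP (size w); elim: k w => // k IH w wk wb.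
case/lastP: w wk wb => [|w i]; first by exists [::].
rewrite size_rcons !ltnS => wk wb.
have [wpos|/exchange[v vw vE]] := root_coef_sign (word_root w (simple_root i)).
  have bi0 : dot b (alpha i) = 0.
    apply/eqP; rewrite eq_le bdom andbT.
    rewrite -(word_isometry (rcons w i)) wb word_rcons.
    rewrite reflection_self ?simple_neq0//.
    rewrite (_ : word w (- alpha i) = - word w (alpha i)); last first.
      by elim: (w) => //= j u ->; rewrite linearN.
    rewrite dotNr oppr_le0 dotC dot_expansion sumr_ge0// => j _.
    by rewrite mulr_ge0// dotC.
  have [|v vb vE] := IH w wk.
    by rewrite -[RHS]wb word_rcons reflection_id.
  exists (rcons v i); first by rewrite all_rcons bi0 eqxx.
  by move=> x; rewrite !word_rcons vE.
have [||v' v'b v'E] := IH v; first exact: ltn_trans vw wk.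
  by rewrite -vE -word_rcons.
by exists v' => // x; rewrite word_rcons vE.
Qed.

(** Induction on the height of a positive root: one that is not simple pairs positively with some
    [alpha i], and [s_ i] sends it to a positive root of smaller height, whose reflection is
    conjugate to the given one by [s_ i]. *)
Lemma reflection_word b : b \in Phi ->
  exists w, forall x, reflection dot b x = word w x.
Proof.
suff pos N a : a \in Phi -> (forall i, 0 <= dot a (omega i)) ->
    \sum_i dot a (omega i) < N%:R ->
    exists w, forall x, reflection dot a x = word w x.
  move=> bP; have [c [cE|cE]] := root_coef_nat bP.
    apply: (pos (\sum_i c i).+1) => // [i|]; first by rewrite cE ler0n.
    by rewrite (eq_bigr _ (fun i _ => cE i)) -natr_sum ltr_nat.
  have [|||w wE] := pos (\sum_i c i).+1 (- b); first exact: root_opp.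
  - by move=> i; rewrite dotNl cE opprK ler0n.
  - rewrite (eq_bigr (fun i => (c i)%:R)) => [|i _]; last first.
      by rewrite dotNl cE opprK.
    by rewrite -natr_sum ltr_nat.
  - by exists w => x; rewrite -wE reflectionN.
elim: N a => [|N IH] a aP apos aN.
  have : 0 <= \sum_i dot a (omega i) by rewrite sumr_ge0.
  by rewrite leNgt aN.
have [/existsP[i /eqP ->]|/existsPn anot] := boolP [exists i, a == alpha i].
  by exists [:: i].
(* Otherwise [dot a a] would be a sum of nonpositive terms. *)
have [i ai] : exists i, 0 < dot a (alpha i).
  apply/not_existsP => aneg.
  have := dot_gt0 dot (root_nonzero aP); rewrite dot_expansion ltNge.
  rewrite -oppr_ge0 -sumrN sumr_ge0// => i _.
  rewrite -mulrN mulr_ge0// oppr_ge0 dotC leNgt; exact/negP.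
have sP := reflection_root (simple_root i) aP.
have spos := simple_reflection_pos aP apos (anot i).
have [|w wE] := IH _ sP spos.
  (* Heights are natural numbers, so a strict decrease lowers the bound by one. *)
  have [[c cE] [d dE]] := (root_pos_coef_nat aP apos, root_pos_coef_nat sP spos).
  move: aN; rewrite (eq_bigr _ (fun j _ => cE j)) -natr_sum ltr_nat ltnS => cN.
  rewrite (eq_bigr _ (fun j _ => dE j)) -natr_sum ltr_nat; apply: leq_trans cN.
  rewrite -(ltr_nat R) !natr_sum -(eq_bigr _ (fun j _ => cE j)).
  rewrite -(eq_bigr _ (fun j _ => dE j)) (bigD1 i)//= [ltRHS](bigD1 i)//=.
  rewrite ltr_leD ?coef_reflection_lt// ler_sum// => j ji.
  by rewrite coef_simple_reflection_neq// eq_sym.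
exists (i :: rcons w i) => x /=.
rewrite word_rcons -wE reflection_conj ?simple_neq0//.
by rewrite !reflectionK ?simple_neq0.
Qed.

Lemma word_lin_subgroup (A : pred 'I_n) :
  lin_subgroup [set f : 'End(E) | exists2 w, all A w & forall x, f x = word w x].
Proof.
have ker0 (f : 'End(E)) w : (forall x, f x = word w x) -> lker f = 0%VS.
  move=> fE; apply/eqP/lker0P => x y; rewrite !fE => /(congr1 (word (rev w))).
  by rewrite !wordK.
split=> [f [w _ /ker0//]||f g [u uA fE] [v vA gE]|f [w wA fE]].
- by exists [::] => // x; rewrite id_lfunE.
- by exists (u ++ v) => [|x]; rewrite ?all_cat ?uA// comp_lfunE fE gE word_cat.
- exists (rev w) => [|x]; first by rewrite all_rev.
  rewrite -{1}[x](wordVK w) -fE lker0_lfunK//.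
  exact/eqP/(ker0 f w).
Qed.

Lemma weyl_group_word f : reflection_group dot [set` Phi] f ->
  exists w, forall x, f x = word w x.
Proof.
have sub : reflection_group dot [set` Phi] `<=` [set f : 'End(E) |
    exists2 w, all xpredT w & forall x, f x = word w x].
  apply: smallest_sub; first exact: word_lin_subgroup.
  move=> _ [a /reflection_word[w wE] <-]; exists w; first exact: all_predT.
  by move=> x; rewrite lfunE/= wE.
by move=> /sub[w _ fE]; exists w.
Qed.

Lemma word_lfun w : exists g : 'End(E), forall x, g x = word w x.
Proof.
elim: w => [|j v [g gE]]; first by exists \1%VF => x; rewrite id_lfunE.
by exists (linfun (s_ j) \o g)%VF => x; rewrite comp_lfunE lfunE gE.
Qed.

Lemma word_reflection_group (G : set E) (A : pred 'I_n)
    (f : 'End(E)) w :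
  (forall i, A i -> G (alpha i)) -> all A w -> (forall x, f x = word w x) ->
  reflection_group dot G f.
Proof.
move=> AG wA fE H [[_ H1 Hc _] GH].
elim: w wA f fE => [_|i w IH /= /andP[iA wA]] f fE.
  by rewrite (_ : f = \1%VF)//; apply/lfunP => x; rewrite fE id_lfunE.
have [g gE] := word_lfun w.
rewrite (_ : f = (linfun (s_ i) \o g)%VF).
  by apply: Hc; [apply: GH; exists (alpha i) => //; exact: AG|exact: IH].
by apply/lfunP => x; rewrite comp_lfunE fE gE lfunE.
Qed.

(** * The roots of a standard parabolic face *)

Context (theta : E) (m : 'I_n -> R).
Context (theta_highest : highest_root Phi alpha theta).
Context (theta_coef : theta = \sum_i m i *: alpha i).

Local Notation F := (face dot Phi omega m).

Lemma coef_highest i : dot theta (omega i) = m i.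
Proof.
rewrite theta_coef dot_suml (bigD1 i)//= big1 ?addr0 => [|j ji].
  by rewrite dotZl coef_simple eqxx mulr1.
by rewrite dotZl coef_simple (negbTE ji) mulr0.
Qed.

Lemma highest_in : theta \in Phi.
Proof. by case: theta_highest. Qed.

(** Integrality of the defects makes their sums usable as induction measures. *)
Lemma coef_defect_nat b : b \in Phi -> exists k : 'I_n -> nat,
  forall i, m i - dot b (omega i) = (k i)%:R.
Proof.
move=> bP; case: theta_highest => _ /(_ _ bP)[k kE]; exists k => i.
by rewrite -coef_highest -dotBl kE coef_nat_sum.
Qed.

Lemma coef_le b i : b \in Phi -> dot b (omega i) <= m i.
Proof. by move=> /coef_defect_nat[k kE]; rewrite -subr_ge0 kE ler0n. Qed.

Lemma highest_dominant i : 0 <= dot theta (alpha i).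
Proof.
rewrite -coef_reflection_le coef_highest coef_le//.
exact/reflection_root/highest_in/simple_root.
Qed.

(** * Closure and border of an index set *)

Definition face_root (I : {set 'I_n}) (b : E) : Prop :=
  b \in Phi /\ forall i, i \in I -> dot b (omega i) = m i.

Definition face_closure (I : {set 'I_n}) : {set 'I_n} :=
  finset (fun i => `[< forall b, face_root I b -> dot b (omega i) = m i >]).

(** The first disjunct is adjacency to [alpha0], whose finite part is [- theta]. *)
Definition face_border (I : {set 'I_n}) : {set 'I_n} :=
  finset (fun i => (i \in face_closure I) && ((dot theta (alpha i) != 0) ||
    [exists j, (j \notin face_closure I) && (dot (alpha j) (alpha i) != 0)])).

Lemma face_closureP I i :
  reflect (forall b, face_root I b -> dot b (omega i) = m i)
          (i \in face_closure I).
Proof. by rewrite inE; exact: asboolP. Qed.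

Lemma notin_face_closureP I i : i \notin face_closure I ->
  exists2 b, face_root I b & dot b (omega i) < m i.
Proof.
move=> iI; apply: contrapT => nob; move/negP: iI; apply.
apply/face_closureP => b bI; apply/eqP; rewrite eq_le coef_le; last by case: bI.
by rewrite leNgt; apply/negP => lt; apply: nob; exists b.
Qed.

Lemma face_root_highest I : face_root I theta.
Proof. by split=> [|i _]; [exact: highest_in|exact: coef_highest]. Qed.

Lemma face_root_reflection (I : {set 'I_n}) b i : i \notin I -> face_root I b ->
  face_root I (s_ i b).
Proof.
move=> iI [bP bI]; split; first exact/reflection_root/bP/simple_root.
move=> j jI; rewrite coef_simple_reflection_neq ?bI//.
by apply: contraNneq iI => ->.
Qed.

Lemma sub_face_closure (I : {set 'I_n}) : I \subset face_closure I.
Proof. by apply/fintype.subsetP => i iI; apply/face_closureP => b [_ ->]. Qed.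

Lemma defect_expansion x y : dot (theta - x) y =
  \sum_i (m i - dot x (omega i)) * dot (alpha i) y.
Proof.
rewrite dot_expansion; apply: eq_bigr => i _.
by rewrite dotBl coef_highest.
Qed.

(* If [b] misses a maximal coefficient on [B], it pairs negatively with some
   [alpha i], [i \in B]; reflecting brings it closer to [theta] along [B]. By
   induction the reflected root has maximal coefficients on [B], so it is
   orthogonal to [alpha i], and hence so is [b]. *)
Lemma orthogonal_part_maximal (I B : {set 'I_n}) b :
  (forall j, j \in B -> dot theta (alpha j) = 0) ->
  (forall i j, i \notin I -> i \notin B -> j \in B ->
    dot (alpha i) (alpha j) = 0) ->
  face_root I b -> forall j, j \in B -> dot b (omega j) = m j.
Proof.
move=> Btheta Borth.
suff H N : forall a, face_root I a ->
    \sum_(i in B) (m i - dot a (omega i)) < N%:R ->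
    forall j, j \in B -> dot a (omega j) = m j.
  move=> bI; have [k kE] := coef_defect_nat bI.1.
  apply: (H (\sum_(i in B) k i).+1 b bI).
  by rewrite (eq_bigr _ (fun i _ => kE i)) -natr_sum ltr_nat.
elim: N => [|N IH] a aI aN.
  have : 0 <= \sum_(i in B) (m i - dot a (omega i)).
    by rewrite sumr_ge0// => i _; rewrite subr_ge0 coef_le//; case: aI.
  by rewrite leNgt aN.
(* In the expansion of [theta - c] the terms outside [B] vanish: on [I] the defect is zero, and off
   [I] the simple root is orthogonal to [alpha i]. *)
have outB c i : face_root I c -> i \in B ->
    dot c (alpha i) = - \sum_(j in B)
      (m j - dot c (omega j)) * dot (alpha j) (alpha i).
  move=> [_ cI] iB.
  have := defect_expansion c (alpha i); rewrite dotBl (Btheta _ iB) sub0r.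
  move=> /(canRL opprK) ->; congr (- _); rewrite (bigID (mem B))/=.
  rewrite [X in _ + X]big1 ?addr0// => j jB.
  have [jI|jI] := boolP (j \in I); first by rewrite cI// subrr mul0r.
  by rewrite Borth ?mulr0.
(* This is the part of [theta - a] supported on [B]. If no [alpha i] with [i \in B] paired
   negatively with [a], then [outB] would make [dot g g] nonpositive. *)
pose g := \sum_(j in B) (m j - dot a (omega j)) *: alpha j.
have gE j : j \in B -> dot g (omega j) = m j - dot a (omega j).
  move=> jB; rewrite dot_suml (bigD1 j)//= big1 ?addr0 => [|i /andP[_ ij]].
    by rewrite dotZl coef_simple eqxx mulr1.
  by rewrite dotZl coef_simple (negbTE ij) mulr0.
have [g0|g0] := eqVneq g 0.
  move=> j jB; apply/esym/eqP; rewrite -subr_eq0 -gE// g0.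
  by rewrite -[0](subrr g) dotBl subrr.
have [i [iB ai]] : exists i, i \in B /\ dot a (alpha i) < 0.
  apply: contrapT => noi; have := dot_gt0 dot g0; rewrite ltNge => /negP; apply.
  rewrite {1}/g dot_suml -oppr_ge0 -sumrN sumr_ge0// => j jB.
  rewrite dotZl -mulrN mulr_ge0 ?subr_ge0 ?coef_le//; first by case: aI.
  have -> : - dot (alpha j) g = dot a (alpha j).
    rewrite outB// dotC /g dot_suml; congr (- _).
    by apply: eq_bigr => l _; rewrite dotZl.
  by rewrite leNgt; apply/negP => aj; apply: noi; exists j.
have iI : i \notin I.
  apply/negP => iI; have := ai; rewrite -coef_reflection_gt aI.2// ltNge.
  by rewrite coef_le//; apply: reflection_root; [exact: simple_root|case: aI].
have sI := face_root_reflection iI aI.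
have smax : forall j, j \in B -> dot (s_ i a) (omega j) = m j.
  apply: IH => //.
  have [[c cE] [d dE]] := (coef_defect_nat aI.1, coef_defect_nat sI.1).
  move: aN; rewrite (eq_bigr _ (fun j _ => cE j)) -natr_sum ltr_nat ltnS => cN.
  rewrite (eq_bigr _ (fun j _ => dE j)) -natr_sum ltr_nat; apply: leq_trans cN.
  rewrite -(ltr_nat R) !natr_sum -(eq_bigr _ (fun j _ => cE j)).
  rewrite -(eq_bigr _ (fun j _ => dE j)) (bigD1 i)//= [ltRHS](bigD1 i)//=.
  rewrite ltr_leD ?ltrD2l ?ltrN2 ?coef_reflection_gt// ler_sum// => j /andP[_ ji].
  by rewrite coef_simple_reflection_neq// eq_sym.
have : dot (s_ i a) (alpha i) = 0.
  rewrite outB// big1 ?oppr0// => j jB.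
  by rewrite smax// subrr mul0r.
rewrite reflection_swap ?simple_neq0// reflection_self ?simple_neq0// dotNr.
by move/eqP; rewrite oppr_eq0 lt_eqF.
Qed.

(** Both [b] and [s_ i b] are roots of the face, so they share the coefficient [m i] at [i]; the
    reflection preserves it only if the pairing is zero. *)
Lemma face_root_orthogonal (I : {set 'I_n}) i b :
  i \in face_closure I -> i \notin I -> face_root I b -> dot b (alpha i) = 0.
Proof.
move=> /face_closureP iI iNI bI; apply/eqP; rewrite eq_le !leNgt.
rewrite -coef_reflection_gt -coef_reflection_lt (iI _ bI).
by rewrite (iI _ (face_root_reflection iNI bI)) ltxx.
Qed.

(** Take a face root [b] with a positive defect at [j]. Both [theta] and [b] are orthogonal to
    [alpha i], while [dot (theta - b) (alpha i)] expands into nonpositive terms, so the term at [j]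
    vanishes. *)
Lemma face_closure_orthogonal (I : {set 'I_n}) i j :
  i \in face_closure I -> i \notin I -> j \notin face_closure I ->
  dot (alpha j) (alpha i) = 0.
Proof.
move=> iI iNI jI; have [b bI bj] := notin_face_closureP jI.
have orth := face_root_orthogonal iI iNI.
have ij : j != i by apply: contraNneq jI => ->.
apply/eqP; rewrite eq_le simple_obtuse//= leNgt; apply/negP => ji.
have := defect_expansion b (alpha i).
rewrite dotBl !orth//; last exact: face_root_highest.
rewrite subr0 => /esym/eqP; rewrite lt_eqF// (bigD1 j)//=.
rewrite ltr_wnDr ?pmulr_rlt0 ?subr_gt0//.
rewrite -oppr_ge0 -sumrN sumr_ge0// => l _; rewrite -mulrN.
have [->|li] := eqVneq l i.
  by rewrite (face_closureP _ _ iI b bI) subrr mul0r.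
by rewrite mulr_ge0 ?subr_ge0 ?coef_le ?oppr_ge0 ?simple_obtuse//; case: bI.
Qed.

Lemma face_border_sub (I : {set 'I_n}) : face_border I \subset I.
Proof.
apply/fintype.subsetP => i; rewrite inE => /andP[iI]; apply: contraTT => iNI.
rewrite negb_or negbK (face_root_orthogonal iI iNI (face_root_highest I)) eqxx/=.
apply/existsPn => j; apply/negP => /andP[jI].
by rewrite (face_closure_orthogonal iI iNI jI) eqxx.
Qed.

Lemma notin_face_border (I : {set 'I_n}) i :
  i \in face_closure I -> i \notin face_border I ->
  dot theta (alpha i) = 0 /\
  forall j, j \notin face_closure I -> dot (alpha j) (alpha i) = 0.
Proof.
move=> iI; rewrite inE iI/= negb_or negbK => /andP[/eqP iT /existsPn iorth].
split=> // j jI; apply/eqP; have := iorth j.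
by rewrite jI/= negbK.
Qed.

Lemma face_root_closure (I : {set 'I_n}) b :
  face_root I b -> face_root (face_closure I) b.
Proof. by move=> bI; split=> [|i /face_closureP]; [case: bI|exact]. Qed.

Lemma face_root_sub (I J : {set 'I_n}) b : J \subset face_closure I ->
  face_root I b -> face_root J b.
Proof.
move=> /fintype.subsetP JI /face_root_closure[bP bI].
by split=> // i /JI; exact: bI.
Qed.

Lemma face_closure_sub (I J : {set 'I_n}) :
  (forall b, face_root J b -> face_root I b) ->
  face_closure I \subset face_closure J.
Proof.
move=> JI; apply/fintype.subsetP => i /face_closureP iI.
by apply/face_closureP => b /JI; exact: iI.
Qed.

(** The border depends on [I] through the closure alone, which gives one direction. For the other,
    the indices of the closure missing from [J] lie off the border, and [orthogonal_part_maximal]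
    shows that their coefficients are still maximal. *)
Lemma face_closure_eqP (I J : {set 'I_n}) :
  face_closure J = face_closure I <->
  face_border I \subset J /\ J \subset face_closure I.
Proof.
split=> [JI|[bJ Jc]].
  split; last by rewrite -JI sub_face_closure.
  rewrite (_ : face_border I = face_border J) ?face_border_sub//.
  by rewrite /face_border JI.
apply/eqP; rewrite finset.eqEsubset; apply/andP.
split; apply: face_closure_sub => b; first exact: face_root_sub.
move=> bJ'; have [bP bJm] := bJ'; split=> // i iI.
have iC := fintype.subsetP (sub_face_closure I) i iI.
have [/bJm//|iJ] := boolP (i \in J).
have border j : j \in face_closure I :\: J -> dot theta (alpha j) = 0 /\
    forall l, l \notin face_closure I -> dot (alpha l) (alpha j) = 0.
  rewrite inE => /andP[jJ jI]; apply: notin_face_border => //.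
  by apply: contra jJ; exact: fintype.subsetP.
apply: (@orthogonal_part_maximal J (face_closure I :\: J) b) => //.
- by move=> j /border[].
- move=> l j lJ lB /border[_]; apply.
  by apply: contra lB => lI; rewrite finset.inE lJ.
- by rewrite inE iJ.
Qed.

(* Together with [face_closure_orthogonal], this identifies the complement of
   the closure with the connected component of [alpha0]. *)
Lemma face_closure_connected (I B : {set 'I_n}) :
  B \subset ~: face_closure I ->
  (forall j, j \in B -> dot theta (alpha j) = 0) ->
  (forall i j, i \notin face_closure I -> i \notin B -> j \in B ->
    dot (alpha i) (alpha j) = 0) ->
  B = finset.set0.
Proof.
move=> /fintype.subsetP BI Btheta Borth; apply/eqP/set0Pn => -[j jB].
have := BI j jB; rewrite inE => /negP; apply; apply/face_closureP => b bI.
exact: orthogonal_part_maximal Btheta Borth (face_root_closure bI) j jB.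
Qed.

(** Let [B] be the set of indices violating the claim. If [b] pairs nontrivially with [alpha l],
    then [s_ l b] is again a face root, and orthogonality of [alpha j] to both, for [j \in B],
    forces orthogonality to [alpha l]. So [face_closure_connected] empties [B]. *)
Lemma face_root_nonorthogonal (I : {set 'I_n}) i : i \notin face_closure I ->
  exists2 b, face_root I b & dot b (alpha i) != 0.
Proof.
move=> iI; pose P j := exists2 b, face_root I b & dot b (alpha j) != 0.
pose B := finset (fun j => (j \notin face_closure I) && ~~ `[< P j >]).
apply: contrapT => iP.
suff B0 : B = finset.set0.
  by have := finset.in_set0 i; rewrite -B0 inE iI (asboolF iP).
have Borth j b : j \in B -> face_root I b -> dot b (alpha j) = 0.
  rewrite inE => /andP[_ /asboolPn Pj] bI; apply/eqP.
  by apply: contrapT => /negP bj; apply: Pj; exists b.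
apply: (@face_closure_connected I).
- by apply/fintype.subsetP => j; rewrite !inE => /andP[].
- by move=> j jB; apply: Borth => //; exact: face_root_highest.
move=> l j lI; rewrite inE lI/= negbK => /asboolP[b bI bl] jB.
have lNI : l \notin I.
  by apply: contra lI; exact/fintype.subsetP/sub_face_closure.
have := Borth j _ jB (face_root_reflection lNI bI).
rewrite dot_reflection Borth// sub0r => /eqP; rewrite oppr_eq0 mulf_eq0.
have := simple_norm_gt0 l; rewrite lt0r => /andP[l0 _].
by rewrite !mulf_eq0 invr_eq0 (negbTE bl) (negbTE l0) pnatr_eq0/= => /eqP.
Qed.

(** * Faces: dimension, stabilizer and barycenter *)

Lemma convex_setP (A : set E) :
  convex_set A <-> forall x y (t : R), 0 < t -> t < 1 -> A x -> A y ->
    A (t *: x + (1 - t) *: y).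
Proof.
rewrite convex_setW; split=> [cA x y t t0 t1 /mem_set xA /mem_set yA|cA x y].
  by have := cA x y xA yA (Itv01 (ltW t0) (ltW t1)) t0 t1; rewrite inE.
by rewrite !inE => xA yA k k0 k1; apply: mem_set; exact: cA.
Qed.

Lemma root_polytope_convex (x y : E) (t : R) : 0 < t -> t < 1 ->
  root_polytope Phi x -> root_polytope Phi y ->
  root_polytope Phi (t *: x + (1 - t) *: y).
Proof.
move=> t0 t1 xP yP A AC; have /convex_setP cA := AC.1.
by apply: cA => //; [exact: xP|exact: yP].
Qed.

Lemma root_polytope_root b : b \in Phi -> root_polytope Phi b.
Proof. by move=> bP A [_]; exact. Qed.

Lemma root_polytope_reflection i x :
  root_polytope Phi x -> root_polytope Phi (s_ i x).
Proof.
suff : root_polytope Phi `<=` [set x | root_polytope Phi (s_ i x)] by exact.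
apply: smallest_sub => [|b bP].
  apply/convex_setP => {}x y t t0 t1 /= xP yP.
  by rewrite linearD !linearZ/=; exact: root_polytope_convex.
exact: root_polytope_root (reflection_root (simple_root i) bP).
Qed.

(* On a proper convex combination the bounded coefficients are maximal only if
   they are maximal at both endpoints, so the implication defining [A] passes
   from the roots to the whole polytope. *)
Lemma face_sub (I J : {set 'I_n}) :
  (forall b, face_root I b -> face_root J b) -> F I `<=` F J.
Proof.
move=> IJ x [xP xI]; split=> //.
pose A := [set y : E | (forall i, dot y (omega i) <= m i) /\
  ((forall i, i \in I -> dot y (omega i) = m i) ->
    forall i, i \in J -> dot y (omega i) = m i)].
suff /(_ _ xP)[_ /(_ xI)] : root_polytope Phi `<=` A by [].
apply: smallest_sub => [|b bP]; last first.
  by split=> [i|bI]; [exact: coef_le|case: (IJ b (conj bP bI))].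
apply/convex_setP => {xP xI}x y t t0 t1 [xle xIJ] [yle yIJ].
have t1' : 0 < 1 - t by rewrite subr_gt0.
have cE i : dot (t *: x + (1 - t) *: y) (omega i) =
  m i - (t * (m i - dot x (omega i)) + (1 - t) * (m i - dot y (omega i))).
  by rewrite dotDl !dotZl; ring.
have xd i : 0 <= t * (m i - dot x (omega i)).
  by apply: mulr_ge0; [exact: ltW|rewrite subr_ge0].
have yd i : 0 <= (1 - t) * (m i - dot y (omega i)).
  by apply: mulr_ge0; [exact: ltW|rewrite subr_ge0].
split=> [i|zI i iJ]; first by rewrite cE gerBl addr_ge0.
have zE j : j \in I -> dot x (omega j) = m j /\ dot y (omega j) = m j.
  move=> /zI; rewrite cE => /eqP; rewrite subr_eq addrC -subr_eq subrr eq_sym.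
  rewrite paddr_eq0// !mulf_eq0 (gt_eqF t0) (gt_eqF t1') !subr_eq0/=.
  by move=> /andP[/eqP <- /eqP <-].
rewrite cE xIJ ?yIJ//; first by rewrite subrr !mulr0 addr0 subr0.
- by move=> j /zE[].
- by move=> j /zE[].
Qed.

Lemma face_face_root (I : {set 'I_n}) b : b \in Phi -> F I b <-> face_root I b.
Proof.
by move=> bP; split=> -[_ bI]; split=> //; exact: root_polytope_root.
Qed.

Lemma face_closure_face (I : {set 'I_n}) : F (face_closure I) = F I.
Proof.
apply/seteqP; split; apply: face_sub => b.
  move=> [bP bI]; split=> // i iI.
  by rewrite bI// (fintype.subsetP (sub_face_closure I)).
exact: face_root_closure.
Qed.

Lemma face_eqP (I J : {set 'I_n}) :
  F J = F I <-> face_closure J = face_closure I.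
Proof.
split=> [FE|cE]; last by rewrite -face_closure_face cE face_closure_face.
apply/eqP; rewrite finset.eqEsubset; apply/andP.
split; apply: face_closure_sub => b /[dup] -[bP _] /(face_face_root _ bP).
  by rewrite -FE => /(face_face_root _ bP).
by rewrite FE => /(face_face_root _ bP).
Qed.

Lemma face_coef (I : {set 'I_n}) x i : F I x -> i \in face_closure I ->
  dot x (omega i) = m i.
Proof. by rewrite -face_closure_face => -[_]; exact. Qed.

Lemma face_dimension (I : {set 'I_n}) :
  has_dimension (F I) (n - #|face_closure I|).
Proof.
pose K := [seq alpha i | i <- enum (~: face_closure I)].
exists theta, <<K>>%VS; split.
- by apply/face_face_root; [exact: highest_in|exact: face_root_highest].
- move=> x xI; rewrite -opprB memvN (simple_expansion (theta - x)).
  apply: memv_suml => i _; rewrite dotBl coef_highest.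
  have [iI|iI] := boolP (i \in face_closure I).
    by rewrite (face_coef xI iI) subrr scale0r mem0v.
  by rewrite memvZ// memv_span// map_f// mem_enum inE.
- move=> U UF; apply/span_subvP => _ /mapP[i + ->].
  rewrite mem_enum inE => iI; have [b bI bi] := face_root_nonorthogonal iI.
  have iNI : i \notin I.
    by apply: contra iI; exact/fintype.subsetP/sub_face_closure.
  have inU c : face_root I c -> c - theta \in U.
    by move=> cI; apply: UF; apply/face_face_root => //; case: cI.
  (* The difference [b - s_ i b] is a nonzero multiple of [alpha i]. *)
  have := memvB (inU _ bI) (inU _ (face_root_reflection iNI bI)).
  rewrite opprB addrA subrK /reflection opprB addrC subrK.
  move=> /(memvZ (2 * dot b (alpha i) / dot (alpha i) (alpha i))^-1).
  rewrite scalerA mulVf ?scale1r// !mulf_eq0 invr_eq0 (negbTE bi) pnatr_eq0/=.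
  by rewrite gt_eqF ?simple_norm_gt0.
- have Kfree : free K.
    case: alpha_basis => /basis_free afree _ _.
    have KE : perm_eq (codom alpha)
        ([seq alpha i | i <- enum (face_closure I)] ++ K).
      rewrite codomE -map_cat perm_map// uniq_perm ?cat_uniq ?enum_uniq//=.
        rewrite andbT; apply/hasPn => i; rewrite !mem_enum inE; exact.
      by move=> i; rewrite mem_cat !mem_enum finset.in_setC orbN.
    by move: afree; rewrite (perm_free KE) => /catr_free.
  rewrite (eqP Kfree) size_map -cardE -[X in (X - _)%N]card_ord.
  by rewrite -(cardsC (face_closure I)) addKn.
Qed.

(** Outside the closure, only an unconstrained coefficient changes. In the closure but off the
    border, [theta] and all simple roots occurring in [theta - x] are orthogonal to [alpha i], so
    [x] is fixed. *)
Lemma face_reflection (I : {set 'I_n}) i x : i \notin face_border I ->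
  F I x -> F I (s_ i x).
Proof.
move=> ib xI; have [xP _] := xI.
have [iI|iI] := boolP (i \in face_closure I); last first.
  split=> [|j jI]; first exact: root_polytope_reflection.
  have jC := fintype.subsetP (sub_face_closure I) j jI.
  rewrite coef_simple_reflection_neq ?(face_coef xI jC)//.
  by apply: contraNneq iI => ->.
have [iT iorth] := notin_face_border iI ib.
have : dot (theta - x) (alpha i) = 0.
  rewrite defect_expansion big1// => j _.
  have [jI|jI] := boolP (j \in face_closure I).
    by rewrite (face_coef xI jI) subrr mul0r.
  by rewrite iorth// mulr0.
rewrite dotBl iT sub0r => /eqP; rewrite oppr_eq0 => /eqP xi.
by rewrite reflection_id.
Qed.

Lemma face_word (I : {set 'I_n}) w x : all [pred i | i \notin face_border I] w ->
  F I x -> F I (word w x).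
Proof.
elim: w => //= i w IH /andP[ib wb] xI.
by apply: face_reflection => //; exact: IH.
Qed.

Lemma border_groupP (I : {set 'I_n}) (f : 'End(E)) :
  reflection_group dot (range alpha `\` simple_roots alpha (face_border I)) f <->
  exists2 w, all [pred i | i \notin face_border I] w & forall x, f x = word w x.
Proof.
set G := _ `\` _; split=> [|[w wb fE]].
  suff : reflection_group dot G `<=` [set f : 'End(E) |
    exists2 w, all [pred i | i \notin face_border I] w &
               forall x, f x = word w x] by exact.
  apply: smallest_sub; first exact: word_lin_subgroup.
  move=> _ [_ [[i _ <-] ib] <-]; exists [:: i] => [|x]; last by rewrite lfunE.
  by rewrite /= andbT; apply/negP => iB; apply: ib; exists i.
apply: word_reflection_group wb fE => i /= ib; split; first by exists i.
by move=> [j /= jb /simple_inj ji]; move: ib; rewrite -ji jb.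
Qed.

(** * Barycenters and stabilizers *)

Local Notation face_seq I := [seq x <- Phi | `[< F I x >]].

Lemma mem_face_seq (I : {set 'I_n}) b :
  reflect (face_root I b) (b \in face_seq I).
Proof.
rewrite mem_filter; apply: (iffP andP) => [[/asboolP bF bP]|bI].
  exact/face_face_root.
have bP := bI.1; split=> //; exact/asboolP/face_face_root.
Qed.

Lemma face_seq_gt0 (I : {set 'I_n}) : 0 < (size (face_seq I))%:R :> R.
Proof.
rewrite ltr0n lt0n size_eq0; apply: contraTneq isT => s0.
by have /mem_face_seq := face_root_highest I; rewrite s0.
Qed.

(** An injective map preserving the finite set of face roots permutes it. *)
Lemma root_barycenter_word (I : {set 'I_n}) w :
  (forall x, F I x -> F I (word w x)) ->
  word w (root_barycenter Phi (F I)) = root_barycenter Phi (F I).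
Proof.
move=> wF; rewrite /root_barycenter.
have [g gE] := word_lfun w; rewrite -gE linearZ linear_sum/=; congr (_ *: _).
rewrite (eq_bigr _ (fun x _ => gE x)).
rewrite -(big_map (word w) predT id); apply: perm_big.
have suniq : uniq (face_seq I) by rewrite filter_uniq ?fset_uniq.
have wuniq : uniq [seq word w x | x <- face_seq I].
  by rewrite map_inj_uniq//; exact: can_inj (wordK w).
have sub : {subset [seq word w x | x <- face_seq I] <= face_seq I}.
  move=> _ /mapP[x + ->]; rewrite !mem_filter => /andP[/asboolP xF xP].
  by rewrite word_root// andbT; apply/asboolP/wF.
by apply: uniq_perm => //; apply: (uniq_min_size wuniq sub _).2; rewrite size_map.
Qed.

Lemma dot_root_barycenter (I : {set 'I_n}) x :
  dot (root_barycenter Phi (F I)) x =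
  (size (face_seq I))%:R^-1 * \sum_(b <- face_seq I) dot b x.
Proof. by rewrite dotZl dot_suml. Qed.

Lemma barycenter_notin_border (I : {set 'I_n}) i : i \notin face_border I ->
  dot (root_barycenter Phi (F I)) (alpha i) = 0.
Proof.
move=> ib; set b := root_barycenter _ _.
have : word [:: i] b = b.
  apply: root_barycenter_word => x; apply: face_word.
  by rewrite /= ib.
move=> /= sb; apply/eqP; rewrite -eqNr.
rewrite -dotNr -(reflection_self dot (simple_neq0 i)).
by rewrite -reflection_swap ?simple_neq0// sb.
Qed.

(** Since [i \in I], the coefficient at [i] is maximal on the face and reflecting cannot raise it,
    so all face roots pair nonnegatively with [alpha i]. It remains to find one pairing
    positively. *)
Lemma barycenter_border (I : {set 'I_n}) i : i \in face_border I ->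
  0 < dot (root_barycenter Phi (F I)) (alpha i).
Proof.
move=> ib; have iI := fintype.subsetP (face_border_sub I) i ib.
have pos b : face_root I b -> 0 <= dot b (alpha i).
  move=> [bP bI]; rewrite -coef_reflection_le bI// coef_le//.
  exact/reflection_root/bP/simple_root.
rewrite dot_root_barycenter pmulr_rgt0 ?invr_gt0 ?face_seq_gt0//.
have [b bI bi] : exists2 b, face_root I b & 0 < dot b (alpha i).
  move: ib; rewrite inE => /andP[iC /orP[iT|/existsP[j /andP[jC ji]]]].
    exists theta; first exact: face_root_highest.
    by rewrite lt0r iT highest_dominant.
  (* The defect of [b] at the neighbour [j] makes [dot (theta - b) (alpha i)] negative, whereas
     [theta] is dominant. *)
  have [b bI bj] := notin_face_closureP jC; exists b => //.
  have neq : j != i by apply: contraNneq jC => ->.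
  have := defect_expansion b (alpha i); rewrite dotBl => /eqP.
  rewrite subr_eq addrC -subr_eq => /eqP <-.
  rewrite subr_gt0 (lt_le_trans _ (highest_dominant i))// (bigD1 j)//=.
  rewrite ltr_wnDr ?pmulr_rlt0 ?subr_gt0//; last first.
    by rewrite lt_neqAle ji simple_obtuse.
  rewrite -oppr_ge0 -sumrN sumr_ge0// => l _; rewrite -mulrN.
  have [->|li] := eqVneq l i; first by rewrite bI.2// subrr mul0r.
  by rewrite mulr_ge0 ?subr_ge0 ?coef_le ?oppr_ge0 ?simple_obtuse//; case: bI.
have /mem_face_seq bs := bI.
rewrite (bigD1_seq b)//=; last by rewrite filter_uniq ?fset_uniq.
rewrite ltr_wpDr// big_seq_cond sumr_ge0// => c /andP[/mem_face_seq cI _].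
exact: pos.
Qed.

Lemma barycenter_dominant (I : {set 'I_n}) i :
  0 <= dot (root_barycenter Phi (F I)) (alpha i).
Proof.
have [/barycenter_border/ltW//|/barycenter_notin_border ->//] :=
  boolP (i \in face_border I).
Qed.

Lemma barycenter_cone (I : {set 'I_n}) :
  cone [set omega i | i in [set` face_border I]] (root_barycenter Phi (F I)).
Proof.
set b := root_barycenter _ _.
exists #|face_border I|, (fun j => dot b (alpha (enum_val j))),
  (fun j => omega (enum_val j)); split=> [j|j|].
- exact: barycenter_dominant.
- by exists (enum_val j) => //=; exact: enum_valP.
rewrite -(big_enum_val (fun i => dot b (alpha i) *: omega i)).
rewrite {1}(omega_expansion b) (bigID (mem (face_border I)))/=.
rewrite [X in _ + X]big1 ?addr0// => i ib.
by rewrite barycenter_notin_border// scale0r.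
Qed.

(** An element preserving the face fixes its dominant barycenter; [dominant_stabilizer] writes it
    with letters orthogonal to the barycenter, which lie off the border by [barycenter_border]. *)
Lemma face_stabilizer (I : {set 'I_n}) :
  stabilizer (reflection_group dot [set` Phi]) (F I) =
  reflection_group dot (range alpha `\` simple_roots alpha (face_border I)).
Proof.
apply/seteqP; split=> f.
  move=> [/weyl_group_word[w fE] fF]; apply/border_groupP.
  have wF x : F I x -> F I (word w x).
    by move=> xF; rewrite -fE -[X in X _]fF; exists x.
  have [v vb wv] := dominant_stabilizer (barycenter_dominant I)
    (root_barycenter_word wF).
  exists v => [|x]; last by rewrite fE.
  apply: sub_all vb => i /=; apply: contraTN => /barycenter_border.
  by rewrite lt0r => /andP[].
move=> /border_groupP[w wb fE]; split.
  apply: (@word_reflection_group _ predT) fE => [i _|]; first exact: simple_root.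
  exact: all_predT.
apply/seteqP; split=> [_ [x xF <-]|x xF]; first by rewrite fE; exact: face_word.
exists (word (rev w) x); last by rewrite fE wordVK.
by apply: face_word => //; rewrite all_rev.
Qed.

(** * Irreducible parabolic subsystems of the affine root system *)

Local Notation aform := (affine_form dot).
Local Notation hPhi := (generated_subsystem dot Phi).
Local Notation hPi := (affine_simple_roots alpha theta).

Definition affine_complement (I : {set 'I_n}) : set (E * R^o) :=
  hPi `\` (@affine_embed R E @` simple_roots alpha I).

Lemma affine_complementP (I : {set 'I_n}) x : affine_complement I x <->
  x = alpha0 theta \/ exists2 i, i \notin I & x = affine_embed (alpha i).
Proof.
split=> [[[->|[_ [i _ <-] <-]] xI]|[->|[i iI ->]]]; first by left.
- right; exists i => //; apply/negP => iI; apply: xI.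
  by exists (alpha i) => //; exists i.
- split; first by left.
  by move=> [_ _ [_ /esym/eqP]]; rewrite oner_eq0.
- split; first by right; exists (alpha i) => //; exists i.
  by move=> [_ [j jI <-] [/simple_inj ji]]; move: iI; rewrite -ji jI.
Qed.

Lemma affine_roots_reflection a b : affine_roots Phi a -> affine_roots Phi b ->
  affine_roots Phi (reflection aform a b).
Proof.
move=> [aP [k ak]] [bP [l bl]]; split; first exact: reflection_root.
have /intrP[z zE] := root_crystallographic Phi_root aP bP.
exists (l - z * k); rewrite /reflection /= bl ak /affine_form zE.
by rewrite rmorphB rmorphM.
Qed.

Lemma affine_simple_sub : hPi `<=` affine_roots Phi.
Proof.
move=> _ [->|[_ [i _ <-] <-]]; split => /=.
- exact/root_opp/highest_in.
- by exists 1.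
- exact: simple_root.
- by exists 0.
Qed.

Lemma generated_sub_roots G : G `<=` affine_roots Phi ->
  hPhi G `<=` affine_roots Phi.
Proof.
move=> GA; apply: smallest_sub => //; split=> // a b.
exact: affine_roots_reflection.
Qed.

Lemma generated_mono G G' : G `<=` G' -> hPhi G `<=` hPhi G'.
Proof.
by move=> GG' x xG H [Hs G'H]; apply: xG; split=> // y /GG'; exact: G'H.
Qed.

Lemma generated_reflection G a b : hPhi G a -> hPhi G b ->
  hPhi G (reflection aform a b).
Proof.
by move=> aG bG H HG; apply: HG.1.2; [exact: aG|exact: bG].
Qed.

(** Reflecting [b] in [a] subtracts a multiple of [a], so the zeros of a linear functional are
    stable. The scalar [k] is its value on delta. *)
Lemma generated_linear_eq0 G y (k : R) : G `<=` affine_roots Phi ->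
  (forall x, G x -> dot x.1 y + k * x.2 = 0) ->
  forall x, hPhi G x -> dot x.1 y + k * x.2 = 0.
Proof.
move=> GA G0 x xG.
suff /(_ x xG)[] : hPhi G `<=`
  [set x | affine_roots Phi x /\ dot x.1 y + k * x.2 = 0] by [].
apply: smallest_sub => [|z Gz]; last by split; [exact: GA|exact: G0].
split=> [z []//|a b [aA a0] [bA b0]]; split.
  exact: affine_roots_reflection.
rewrite /reflection /=; set t := _ / _.
rewrite -[t *: a.2]/(t * a.2) dotBl dotZl mulrBr [k * (t * _)]mulrCA.
by rewrite addrACA -opprD -mulrDr b0 a0 mulr0 subr0.
Qed.

Lemma generated_orthogonal G y : G `<=` affine_roots Phi ->
  (forall x, G x -> dot x.1 y = 0) -> forall x, hPhi G x -> dot x.1 y = 0.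
Proof.
move=> GA G0 x xG; have := @generated_linear_eq0 G y 0 GA _ x xG.
by rewrite mul0r addr0; apply=> z zG; rewrite mul0r addr0 G0.
Qed.

Lemma affine_complement_sub (I : {set 'I_n}) :
  affine_complement I `<=` affine_roots Phi.
Proof. by move=> x [+ _]; exact: affine_simple_sub. Qed.

Lemma generated_alpha0 (I : {set 'I_n}) :
  hPhi (affine_complement I) (alpha0 theta).
Proof. by apply: sub_gen_smallest; apply/affine_complementP; left. Qed.

(** The functional [dot x.1 (omega i) + m i * x.2] is the coefficient at [alpha i] in the basis of
    affine simple roots: the weight [m i] makes it vanish on [alpha0]. Hence the subsystem
    determines [I]. *)
Lemma generated_simple (I : {set 'I_n}) i :
  hPhi (affine_complement I) (affine_embed (alpha i)) <-> i \notin I.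
Proof.
split=> [iS|iI]; last first.
  by apply: sub_gen_smallest; apply/affine_complementP; right; exists i.
apply/negP => iI.
have := @generated_linear_eq0 _ (omega i) (m i) (@affine_complement_sub I) _ _ iS.
rewrite /= coef_simple eqxx mulr0 addr0 => /(_ _)/eqP; rewrite oner_eq0 => H.
suff : false by []; apply: H => x /affine_complementP[->|[j jI ->]]/=.
  by rewrite dotNl coef_highest mulr1 addNr.
by rewrite coef_simple mulr0 addr0; case: eqP jI => // ->; rewrite iI.
Qed.

(** By connectedness, the block containing [alpha0] contains every simple generator. An element of
    the other block would be orthogonal to all generators, hence to itself, which is impossible as
    its finite part is a root. *)
Lemma face_closure_irreducible (I : {set 'I_n}) :
  irreducible aform (hPhi (affine_complement (face_closure I))).
Proof.
set S := hPhi _; split; first by exists (alpha0 theta); exact: generated_alpha0.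
suff main A B : A `|` B = S -> (forall x y, A x -> B y -> aform x y = 0) ->
    A (alpha0 theta) -> B = set0.
  move=> A B AB orth; have : S (alpha0 theta) by exact: generated_alpha0.
  rewrite -AB => -[A0|B0]; [right|left]; first exact: main AB orth A0.
  apply: main B0; first by rewrite setUC.
  by move=> x y Bx Ay; rewrite /affine_form dotC; exact: orth.
move=> AB orth A0.
have simpleS i : i \notin face_closure I -> S (affine_embed (alpha i)).
  by move=> iI; exact/generated_simple.
pose K := finset (fun i => (i \notin face_closure I) &&
  `[< B (affine_embed (alpha i)) >]).
have K0 : K = finset.set0.
  apply: (@face_closure_connected I).
  - by apply/fintype.subsetP => i; rewrite !inE => /andP[].
  - move=> i; rewrite inE => /andP[_ /asboolP Bi].
    by have /eqP := orth _ _ A0 Bi; rewrite /affine_form/= dotNl oppr_eq0 => /eqP.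
  move=> i j iI iK; rewrite inE => /andP[_ /asboolP Bj].
  have : (A `|` B) (affine_embed (alpha i)) by rewrite AB; exact: simpleS.
  case=> [Ai|Bi]; first exact: orth Ai Bj.
  by move: iK; rewrite inE iI (asboolT Bi).
apply/seteqP; split=> // y By.
have Sy : S y by rewrite -AB; right.
have yP : y.1 \in Phi.
  by case: (generated_sub_roots (@affine_complement_sub _) Sy).
have := root_nonzero yP; rewrite (@dot_eq0 _ _ dot y.1) ?eqxx//.
apply: generated_orthogonal (@affine_complement_sub _) _ _ Sy.
move=> x /affine_complementP[->|[i iI ->]]; first exact: orth A0 By.
have : (A `|` B) (affine_embed (alpha i)) by rewrite AB; exact: simpleS.
case=> [Ai|Bi]; first exact: orth Ai By.
by have := finset.in_set0 i; rewrite -K0 inE iI (asboolT Bi).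
Qed.

(** Indices of the closure outside [I] give simple roots orthogonal to [alpha0] and to the simple
    roots outside the closure. The subsystem is thus a union of two orthogonal ones; the first
    contains [alpha0], so the second is empty. *)
Lemma irreducible_face_closure (I : {set 'I_n}) :
  irreducible aform (hPhi (affine_complement I)) -> face_closure I = I.
Proof.
move=> [_ irr].
pose G1 := affine_complement (face_closure I).
pose G2 := [set affine_embed (alpha i) | i in
  [set i | (i \in face_closure I) && (i \notin I)]].
have G1I : G1 `<=` affine_complement I.
  move=> x /affine_complementP xI; apply/affine_complementP.
  case: xI => [->|[i iI ->]]; [by left|right; exists i => //].
  by apply: contra iI; exact/fintype.subsetP/sub_face_closure.
have G2I : G2 `<=` affine_complement I.
  by move=> _ [i /andP[_ iI] <-]; apply/affine_complementP; right; exists i.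
have G1A : G1 `<=` affine_roots Phi by exact: affine_complement_sub.
have G2A : G2 `<=` affine_roots Phi.
  exact: subset_trans G2I (@affine_complement_sub I).
have orthG x y : G1 x -> G2 y -> dot x.1 y.1 = 0.
  move=> /affine_complementP xG [i /andP[iI iNI] <-].
  case: xG => [->|[j jI ->]]/=; last exact: face_closure_orthogonal iI iNI jI.
  by rewrite dotNl (face_root_orthogonal iI iNI (face_root_highest I)) oppr0.
have orth x y : hPhi G1 x -> hPhi G2 y -> aform x y = 0.
  move=> xS yS; rewrite /affine_form dotC.
  apply: generated_orthogonal yS => // z zG; rewrite dotC.
  by apply: generated_orthogonal xS => // t tG; exact: orthG.
have orth_id x y : aform x y = 0 -> reflection aform y x = x.
  by move=> xy; rewrite /reflection xy mulr0 mul0r scale0r subr0.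
have [|S1|S2] := irr (hPhi G1) (hPhi G2) _ orth.
- apply/seteqP; split=> [x [|]|]; [exact: generated_mono|exact: generated_mono|].
  apply: smallest_sub; last first.
    move=> x /affine_complementP[->|[i iI ->]].
      by left; exact: generated_alpha0.
    have [iC|iC] := boolP (i \in face_closure I); last first.
      by left; exact/generated_simple.
    by right; apply: sub_gen_smallest; exists i => //=; rewrite iC.
  (* By orthogonality, a reflection in one part fixes the other pointwise. *)
  split=> [x [|]|a b [aS|aS] [bS|bS]]; try exact: generated_sub_roots.
  - by left; exact: generated_reflection.
  - right; rewrite orth_id//; rewrite /affine_form dotC; exact: orth.
  - left; rewrite orth_id//; exact: orth.
  - by right; exact: generated_reflection.
- by have := @generated_alpha0 (face_closure I); rewrite -/G1 S1.
apply/eqP; rewrite finset.eqEsubset sub_face_closure andbT.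
apply/fintype.subsetP => i iC; apply: contraT => iI.
suff : hPhi G2 (affine_embed (alpha i)) by rewrite S2.
by apply: sub_gen_smallest; exists i => //=; rewrite iC.
Qed.

Lemma range_face_closure : range face_closure =
  [set I | irreducible aform (hPhi (affine_complement I))].
Proof.
apply/seteqP; split=> [_ [I _ <-]|I /irreducible_face_closure IC].
  exact: face_closure_irreducible.
by exists I.
Qed.

(** * Bijection of faces with affine subsystems *)

Lemma standard_parabolic_alpha0 S :
  standard_parabolic dot Phi alpha theta S -> S (alpha0 theta) ->
  exists I : {set 'I_n}, S = hPhi (affine_complement I).
Proof.
move=> [G Gsub ->] G0.
exists (finset (fun i => ~~ `[< G (affine_embed (alpha i)) >])).
congr (hPhi _); apply/seteqP; split=> x.
  move=> /[dup] xG /Gsub[->|[_ [i _ <-] xE]]; apply/affine_complementP.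
    by left.
  by right; exists i; rewrite ?inE ?negbK//; apply/asboolP; rewrite /= xE.
move=> /affine_complementP[->|[i]]; last first.
  by rewrite inE negbK => /asboolP iG ->.
(* Without [alpha0] among the generators, the delta coordinate would vanish on the whole subsystem,
   but it is 1 on [alpha0]. *)
apply: contrapT => NG0.
have := @generated_linear_eq0 G 0 1 (subset_trans Gsub affine_simple_sub) _ _ G0.
have dot0 z : dot z 0 = 0 by rewrite -[0](subrr z) dotBr subrr.
rewrite dot0 add0r mulr1 => /(_ _)/eqP; rewrite oner_eq0 => H.
suff : false by []; apply: H => y /[dup] yG /Gsub[yE|[_ [i _ <-] <-]].
  by case: NG0; rewrite -yE.
by rewrite dot0 mulr0 addr0.
Qed.

Lemma faces_bij : exists f : set E -> set (E * R^o),
  set_bij (range F)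
    [set S | [/\ standard_parabolic dot Phi alpha theta S,
                 irreducible aform S & S (alpha0 theta)]] f.
Proof.
(* The closure is recovered from the face as a set, so the map does not depend on a choice of index
   set. *)
pose cl (A : set E) :=
  finset (fun i : 'I_n => `[< forall x, A x -> dot x (omega i) = m i >]).
have clF I : cl (F I) = face_closure I.
  apply/finset.setP => i; rewrite inE.
  apply/asboolP/idP => [iF|iI x xI]; last exact: face_coef xI iI.
  by apply/face_closureP => b bI; apply/iF/face_face_root => //; case: bI.
exists (fun A => hPhi (affine_complement (cl A))); split.
- move=> _ [I _ <-]; rewrite /= clF; split.
  + by exists (affine_complement (face_closure I)) => // x [].
  + exact: face_closure_irreducible.
  + exact: generated_alpha0.
(* By [generated_simple] the subsystem determines the closure, which determines the face. *)
- move=> A B /set_mem[I _ <-] /set_mem[J _ <-]; rewrite !clF => SE.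
  apply/face_eqP/finset.setP => i; apply: negb_inj.
  by apply/idP/idP => /generated_simple iI; apply/generated_simple;
    [rewrite -SE|rewrite SE].
- move=> S [/standard_parabolic_alpha0 H irr /H[I SE]].
  exists (F I); first by exists I.
  by rewrite clF irreducible_face_closure ?SE// -SE.
Qed.

End RootBasis.

Theorem mainTheorem2 (R : realType) (E : vectType R) (dot : {dot E for idfun})
    (Phi : {fset E}) (n : nat) (alpha : 'I_n -> E) (theta : E)
    (m : 'I_n -> R) (omega : 'I_n -> E)
    (Phi_root : root_system dot Phi)
    (Phi_irr : irreducible dot [set` Phi])
    (alpha_basis : root_basis Phi alpha)
    (theta_highest : highest_root Phi alpha theta)
    (theta_coef : theta = \sum_i m i *: alpha i)
    (omega_dual : forall i j, dot (omega i) (alpha j) = (i == j)%:R) :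
  let F := face dot Phi omega m in
  let Pi_ := simple_roots alpha in
  let Pi := range alpha in
  let hPi := affine_simple_roots alpha theta in
  let hPi_ := fun I => @affine_embed R E @` Pi_ I in
  let hPhi := generated_subsystem dot Phi in
  let W := reflection_group dot in
  (exists bd cl : {set 'I_n} -> {set 'I_n},
    [/\ forall I : {set 'I_n},
          [set J : {set 'I_n} | F J = F I] =
          [set J : {set 'I_n} | bd I \subset J /\ J \subset cl I],
        forall I : {set 'I_n}, has_dimension (F I) (n - #|cl I|),
        forall I : {set 'I_n},
          stabilizer (W [set` Phi]) (F I) = W (Pi `\` Pi_ (bd I)),
        forall I : {set 'I_n},
          cone [set omega i | i in [set` bd I]] (root_barycenter Phi (F I))
      & range cl =
        [set I : {set 'I_n} |
          irreducible (affine_form dot) (hPhi (hPi `\` hPi_ I))]]) /\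
  (exists f : set E -> set (E * R^o),
    set_bij (range F)
      [set S | [/\ standard_parabolic dot Phi alpha theta S,
                   irreducible (affine_form dot) S
                 & S (alpha0 theta)]] f).
Proof.
move=> F Pi_ Pi hPi hPi_ hPhi W; split; last exact: faces_bij.
pose bd := face_border dot Phi alpha omega theta m.
pose cl := face_closure dot Phi omega m.
have FE (I J : {set 'I_n}) : F J = F I <-> cl J = cl I.
  exact: (face_eqP omega_dual theta_highest theta_coef).
have clE (I J : {set 'I_n}) : cl J = cl I <-> bd I \subset J /\ J \subset cl I.
  exact: face_closure_eqP.
exists bd, cl; split=> [I|I|I|I|].
- by apply/seteqP; split=> J; have [] := iff_trans (FE I J) (clE I J).
- exact: (face_dimension Phi_root alpha_basis omega_dual theta_highest
    theta_coef).
- exact: (face_stabilizer Phi_root alpha_basis omega_dual theta_highest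
    theta_coef).
- exact: (barycenter_cone Phi_root alpha_basis omega_dual theta_highest
    theta_coef).
- exact: (range_face_closure Phi_root alpha_basis omega_dual theta_highest
    theta_coef).
Qed.
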